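(* Let $k,n\in\mathbb{N}^+$ and $\boldsymbol{C}=(c_0,c_1,\ldots,c_k)\in\{0,1\}^{k+1}$, and let $c_{p_1},c_{p_2},\ldots,c_{p_q}$ be all the entries of $\boldsymbol{C}$ that are equal to $1$. In the $k$-dimensional color boards problem with $n$ boards, for every $m\in\mathbb{N}$ the number of ways (arrangements of heights) in which exactly $m$ colors are seen $p_1$ or $p_2$ or $\ldots$ or $p_q$ times equals $O_{\boldsymbol{C}}(n,m)$.
   Context: $k$-dimensional color boards problem: there are $n$ boards standing in a fixed sequence $1,2,\ldots,n$ along the viewing direction. Each board is painted one color (different boards having different colors) and is divided into $k$ smaller boards. For each $j\in\{1,\ldots,k\}$, the $j$th smaller boards of the $n$ boards form a group, and their heights $h_{1j},\ldots,h_{nj}$ are $1,2,\ldots,n$ in some order. A way is a choice of the heights $(h_{ij})$, i.e. of one permutation for each of the $k$ groups. Looking along the viewing direction, the $j$th smaller board of board $i$ is seen iff it is higher than the $j$th smaller boards of all boards in front of it, i.e. $h_{ij}>h_{i'j}$ for all $i'<i$. The number of times the color of board $i$ is seen is the number of $j\in\{1,\ldots,k\}$ for which the $j$th smaller board of board $i$ is seen. Optimization set: let $U$ be a finite set of $d$-dimensional vectors and $\boldsymbol{R}=(R_1,\ldots,R_d)$ a vector of relations; write $(\boldsymbol{x},\boldsymbol{y})\in\boldsymbol{R}$ if $(x_i,y_i)\in R_i$ for all $i$. A subset $A\subseteq U$ is a majorization set of $U$ by $\boldsymbol{R}$ if for every $\boldsymbol{u}\in U$ there is $\boldsymbol{a}\in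 A$ with $(\boldsymbol{a},\boldsymbol{u})\in\boldsymbol{R}$ or $\boldsymbol{a}=\boldsymbol{u}$. An optimization set is a majorization set of minimum cardinality. $\boldsymbol{C}$ sequential optimization numbers: let $k,n\ge1$ and $\boldsymbol{C}=(c_0,\ldots,c_k)\in\{0,1\}^{k+1}$. Consider arrays $(a_{ij})_{1\le i\le n,\,1\le j\le k}$ such that for each $j$ the sequence $(a_{1j},\ldots,a_{nj})$ is a permutation of $\{1,\ldots,n\}$ (there are $n!^k$ such arrays). For each $j$ let $b_{ij}=(i,a_{ij})$, $U_j=\{b_{1j},\ldots,b_{nj}\}$, and let $S_j$ be the optimization set of $U_j$ by $(<,<)$ (so $b_{ij}\in S_j$ iff $a_{ij}<a_{i'j}$ for all $i'<i$). For each $i$ let $l_i$ be the number of $j\in\{1,\ldots,k\}$ with $b_{ij}\in S_j$; the index $i$ is selected iff $c_{l_i}=1$. Then $O_{\boldsymbol{C}}(n,m)$ is the number of arrays for which exactly $m$ indices $i\in\{1,\ldots,n\}$ are selected. *)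

(* Defs.v *)
From mathcomp Require Import all_boot all_fingroup.
From mathcomp Require Import finmap.

Set Implicit Arguments.
Unset Strict Implicit.
Unset Printing Implicit Defensive.

Local Open Scope fset_scope.

Section OptimizationSet.

Variables (X : choiceType) (d : nat).
Implicit Types (R : d.-tuple (rel X)) (U A : {fset d.-tuple X}).

Definition vec_rel R (x y : d.-tuple X) : bool :=
  [forall t : 'I_d, tnth R t (tnth x t) (tnth y t)].

Definition majorization_set R U A : bool :=
  (A `<=` U) &&
  [forall u : U, [exists a : A, vec_rel R (val a) (val u) || (val a == val u)]].

Definition optimization_set R U A : bool :=
  majorization_set R U A &&
  [forall B : fpowerset U, majorization_set R U (val B) ==> (#|` A| <= #|` val B|)].

(* U is itself a majorization set, so an optimization set exists and the
   default value is never used.  When the relation is a strict partial order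
   the optimization set is unique (it consists of the minimal elements), so
   that the choice made by [pick] is irrelevant. *)
Definition the_optimization_set R U : {fset d.-tuple X} :=
  if [pick A : fpowerset U | optimization_set R U (val A)] is Some A
  then val A else fset0.

End OptimizationSet.

(* Column j of an array is the permutation a j of 'I_n; positions and values
   are shifted by one so that both range over {1, ..., n}. *)
Definition array (n k : nat) := {ffun 'I_k -> 'S_n}.

Definition entry (n k : nat) (a : array n k) (i : 'I_n) (j : 'I_k) : nat :=
  (a j i).+1.

Section ColorBoards.

Variables (n k : nat) (h : array n k).

Definition seen (i : 'I_n) (j : 'I_k) : bool :=
  [forall i' : 'I_n, (i' < i) ==> (entry h i' j < entry h i j)].

(* Boards have pairwise different colors, so colors are identified with the
   indices of the boards. *)
Definition times_seen (i : 'I_n) : nat := #|[set j : 'I_k | seen i j]|.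

End ColorBoards.

Section SequentialOptimizationNumbers.

Variables (n k : nat).

Definition point (a : array n k) (i : 'I_n) (j : 'I_k) : 2.-tuple nat :=
  [tuple i.+1; entry a i j].

Definition point_set (a : array n k) (j : 'I_k) : {fset 2.-tuple nat} :=
  [fset point a i j | i in 'I_n].

Definition opt_points (a : array n k) (j : 'I_k) : {fset 2.-tuple nat} :=
  the_optimization_set [tuple (ltn : rel nat); (ltn : rel nat)] (point_set a j).

Definition opt_count (a : array n k) (i : 'I_n) : nat :=
  #|[set j : 'I_k | point a i j \in opt_points a j]|.

(* opt_count a i <= k, so nth never returns its default value. *)
Definition selected (C : k.+1.-tuple bool) (a : array n k) (i : 'I_n) : bool :=
  nth false C (opt_count a i).

Definition seq_opt_number (C : k.+1.-tuple bool) (m : nat) : nat :=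
  #|[set a : array n k | #|[set i : 'I_n | selected C a i]| == m]|.

End SequentialOptimizationNumbers.

(* Main.v *)
(** Reversing all heights, [h |-> n + 1 - h], is an involution on arrays which turns
"higher than every board in front" into "smaller than every earlier entry".  The
latter says that the point (i, a_ij) is minimal in U_j, and for a strict partial
order the minimal elements form the unique optimization set: every majorization
set contains them, and by finiteness they already majorize. *)

Require Import Defs.
From mathcomp Require Import all_boot all_fingroup.
From mathcomp Require Import finmap.

Set Implicit Arguments.
Unset Strict Implicit.
Unset Printing Implicit Defensive.

Section StrictOrder.

Local Open Scope fset_scope.

Variables (X : choiceType) (d : nat) (R : d.-tuple (rel X)).
Hypotheses (R_irr : irreflexive (vec_rel R)) (R_trans : transitive (vec_rel R)).
Implicit Types (U A : {fset d.-tuple X}).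

Definition minimal_set U : {fset d.-tuple X} :=
  [fset u in U | [forall v : U, ~~ vec_rel R (val v) u]].

Lemma minimal_setP U u :
  reflect (u \in U /\ forall v, v \in U -> ~~ vec_rel R v u)
          (u \in minimal_set U).
Proof.
rewrite !inE /=; apply: (iffP andP) => -[uU min_u]; split=> //.
  by move=> v vU; have /forallP /(_ [` vU]) := min_u.
by apply/forallP=> v; apply: min_u (valP v).
Qed.

Lemma majorization_setP U A :
  reflect (A `<=` U /\ forall u, u \in U ->
             exists2 a, a \in A & vec_rel R a u || (a == u))
          (majorization_set R U A).
Proof.
apply: (iffP andP) => -[AU maj]; split=> //.
  move=> u uU; have /forallP /(_ [` uU]) /existsP [a au] := maj.
  by exists (val a) => //; apply: valP.
apply/forallP=> u; have [a aA au] := maj _ (valP u).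
by apply/existsP; exists [` aA].
Qed.

(** An element of [A] strictly related to a minimal [u] would contradict minimality, so [u] can only
    be majorized by itself. *)
Lemma minimal_set_sub_majorization U A :
  majorization_set R U A -> minimal_set U `<=` A.
Proof.
case/majorization_setP=> AU maj; apply/fsubsetP=> u /minimal_setP [uU min_u].
have [a aA /orP [au | /eqP <- //]] := maj u uU.
by have := min_u a (fsubsetP AU a aA); rewrite au.
Qed.

(** Descent: from a non-minimal [u] pass to some [v] strictly below it, by induction on the number
    of elements of [U] below [u]. *)
Lemma minimal_set_majorization U : majorization_set R U (minimal_set U).
Proof.
apply/majorization_setP; split; first exact: fset_sub.
move=> u; pose below u := [fset v in U | vec_rel R v u].
have [c] := ubnP #|` below u|; elim: c u => // c IHc u lec uU.
have [min_u | ] := boolP (u \in minimal_set U).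
  by exists u; rewrite // eqxx orbT.
rewrite !inE /= uU /= negb_forall => /existsP [v]; rewrite negbK => vu.
(* Transitivity gives the inclusion; irreflexivity makes it proper, as [val v] is below [u] but not
   below itself. *)
have lt_below : below (val v) `<` below u.
  apply/andP; split; [apply/fsubsetP=> w|apply/fsubsetPn].
    by rewrite !inE /= => /andP [-> wv]; apply: R_trans vu.
  by exists (val v); rewrite !inE /= (valP v) ?vu ?R_irr.
have [||a aM av] := IHc (val v); last 1 first.
- exists a => //; apply/orP; left.
  by case/orP: av => [av | /eqP -> //]; apply: R_trans vu.
- exact: leq_trans (fproper_ltn_card lt_below) _.
- exact: valP.
Qed.

Lemma the_optimization_setE U : the_optimization_set R U = minimal_set U.
Proof.
have MU : minimal_set U \in fpowerset U by rewrite fpowersetE fset_sub.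
rewrite /the_optimization_set.
case: pickP => [A /andP [majA /forallP optA] | noopt].
  (* The chosen [A] contains the minimal set and, being optimal, is no larger. *)
  apply/esym/eqP; rewrite eqEfcard minimal_set_sub_majorization //=.
  by have /implyP := optA [` MU]; apply; apply: minimal_set_majorization.
(* The default branch is contradictory: the minimal set is itself optimal. *)
have /negP [] := negbT (noopt [` MU]).
apply/andP; split; first exact: minimal_set_majorization.
apply/forallP=> B; apply/implyP=> majB.
exact/fsubset_leq_card/minimal_set_sub_majorization.
Qed.

End StrictOrder.

Lemma vec_rel_ltn2 (x y : 2.-tuple nat) :
  vec_rel [tuple (ltn : rel nat); (ltn : rel nat)] x y =
  (tnth x ord0 < tnth y ord0) && (tnth x ord_max < tnth y ord_max).
Proof.
apply/forallP/andP => [xy | [xy0 xy1] t].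
  by split; [have := xy ord0 | have := xy ord_max].
case: t => [[|[|//]] lt_t].
  by rewrite (_ : Ordinal lt_t = ord0) //; apply: val_inj.
by rewrite (_ : Ordinal lt_t = ord_max) //; apply: val_inj.
Qed.

Lemma mem_opt_points n k (a : array n k) i j :
  (point a i j \in opt_points a j) =
  [forall i' : 'I_n, (i' < i) ==> (entry a i j < entry a i' j)].
Proof.
rewrite /opt_points the_optimization_setE; first last.
- move=> y x z; rewrite !vec_rel_ltn2 => /andP [xy0 xy1] /andP [yz0 yz1].
  by rewrite (ltn_trans xy0) ?(ltn_trans xy1).
- by move=> x; rewrite vec_rel_ltn2 !ltnn.
apply/minimal_setP/forallP => [[_ min_i] i' | min_i].
  apply/implyP=> lt_i'i.
  have := min_i (point a i' j) (in_imfset _ _ (erefl : i' \in 'I_n)).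
  (* Minimality yields only a weak inequality of entries; equality is excluded because a column is
     injective and [i' < i]. *)
  rewrite vec_rel_ltn2 !(tnth_nth 0) /= ltnS lt_i'i /= -leqNgt leq_eqVlt.
  rewrite orbC; case: ltnP => //= _; rewrite eqSS.
  by move/eqP/val_inj/perm_inj=> ii'; rewrite ii' ltnn in lt_i'i.
split=> [|v /imfsetP [i' _ ->]]; first exact: in_imfset.
rewrite vec_rel_ltn2 !(tnth_nth 0) /= ltnS.
apply/negP=> /andP [lt_i'i]; have /implyP /(_ lt_i'i) := min_i i'.
by move=> lt1 lt2; have := ltn_trans lt1 lt2; rewrite ltnn.
Qed.

(** The product applies [h j] first, so values rather than positions are reversed. On zero-based
    values this is [v |-> n - 1 - v], hence [n + 1 - h] on entries. *)
Definition rev_heights n k (h : array n k) : array n k :=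
  [ffun j => (h j * perm (@rev_ord_inj n))%g].

Lemma rev_heightsK n k : involutive (@rev_heights n k).
Proof.
by move=> h; apply/ffunP=> j; apply/permP=> i; rewrite !ffunE !permM !permE rev_ordK.
Qed.

Lemma seen_rev_heights n k (h : array n k) i j :
  seen h i j = (point (rev_heights h) i j \in opt_points (rev_heights h) j).
Proof.
rewrite mem_opt_points; apply: eq_forallb => i'; congr (_ ==> _).
rewrite /entry !ffunE !permM !permE /= !ltnS.
by rewrite ltn_sub2lE // ltn_ord.
Qed.

Lemma selected_rev_heights n k (C : k.+1.-tuple bool) (q : nat)
    (p : q.-tuple 'I_k.+1) (p_ones : forall t : 'I_k.+1, (t \in p) = tnth C t)
    (h : array n k) i :
  selected C (rev_heights h) i = [exists r : 'I_q, times_seen h i == tnth p r].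
Proof.
have -> : selected C (rev_heights h) i = nth false C (times_seen h i).
  rewrite /selected /opt_count /times_seen; congr (nth _ _ #|pred_of_set _|).
  by apply/setP=> j; rewrite !inE seen_rev_heights.
(* There are only [k] groups, so the count indexes [C] and the default of [nth] is never reached. *)
have lt_seen : times_seen h i < k.+1.
  by rewrite ltnS -[X in _ <= X]card_ord max_card.
rewrite -[times_seen h i]/(val (Ordinal lt_seen)) -tnth_nth -p_ones.
by apply/tnthP/existsP => -[r]; [move=> -> | move=> /eqP/val_inj]; exists r.
Qed.

Theorem mainTheorem3 (k n : nat) (hk : 0 < k) (hn : 0 < n)
  (C : k.+1.-tuple bool)
  (q : nat) (p : q.-tuple 'I_k.+1) (p_uniq : uniq p)
  (p_ones : forall t : 'I_k.+1, (t \in p) = tnth C t)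
  (m : nat) :
  #|[set h : array n k |
      #|[set i : 'I_n | [exists r : 'I_q, times_seen h i == tnth p r]]| == m]|
  = seq_opt_number n C m.
Proof.
(* Pulling the right-hand set back along the injective reversal keeps its cardinality; the two sets
   then agree array by array. *)
rewrite /seq_opt_number -[RHS](card_preimset _ (can_inj (@rev_heightsK n k))).
congr #|pred_of_set _|; apply/setP=> h; rewrite !inE; congr (_ == m).
by apply: eq_card => i; rewrite !inE (selected_rev_heights p_ones).
Qed.
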